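(* Let $k\ge 1$ be an integer and let $X$ and $Y$ be disjoint finite sets with $\min\{|X|,|Y|\}\ge k+1$. Then the maximum number of edges in a $2k$-free strong bipartite digraph with partite sets $X$ and $Y$ (the Turán number of $2k$-free strong bipartite digraphs with partite sets $X$ and $Y$) is exactly $$(|X|-(k-1))(|Y|-(k-1))+2k-2.$$
   Context: All digraphs are finite, loopless, and have no parallel edges; opposite edges $(x,y)$ and $(y,x)$ are allowed. A digraph $G$ is bipartite with partite sets $X$ and $Y$ if $V(G)$ is the disjoint union of $X$ and $Y$ and every edge of $G$ has one end in $X$ and the other in $Y$. A digraph is $m$-free if it contains no directed cycle of length at most $m$ (a pair of opposite edges is a directed cycle of length $2$). A digraph is strong if every vertex is reachable from every other vertex by a directed path. The Turán number is the maximum number of edges among all digraphs of the stated kind on the fixed vertex set; ''exactly'' means that the value is an upper bound for every such digraph and is attained by some such digraph. *)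

(* Defs.v *)
From mathcomp Require Import all_boot.
Set Implicit Arguments.
Unset Strict Implicit.
Unset Printing Implicit Defensive.

(* Edges are given by a relation, so there are no parallel edges, while
   opposite edges are allowed; the vertex set is all of V. *)
Record digraph (V : finType) := Digraph {
  edge :> rel V;
  edge_irr : irreflexive edge
}.

Section Digraphs.
Variable V : finType.
Implicit Types (G : digraph V) (X Y : {set V}) (c : seq V).

Definition edges G : {set V * V} := [set e | G e.1 e.2].

Definition bipartite X Y G : Prop :=
  [/\ X :|: Y = [set: V], [disjoint X & Y] &
      forall x y, G x y -> x \in X /\ y \in Y \/ x \in Y /\ y \in X].

(* [ucycle] accepts the empty sequence, which is not a directed cycle. *)
Definition dicycle G c : Prop := 0 < size c /\ ucycle G c.

Definition mfree m G : Prop := forall c, dicycle G c -> m < size c.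

Definition strong G : Prop := forall x y, connect G x y.

Definition turan_number (P : digraph V -> Prop) (n : nat) : Prop :=
  (forall G, P G -> #|edges G| <= n) /\
  (exists G, P G /\ #|edges G| = n).

End Digraphs.

(* Main.v *)
Require Import Defs.
From mathcomp Require Import all_boot.
From mathcomp Require Import zify.
Set Implicit Arguments.
Unset Strict Implicit.
Unset Printing Implicit Defensive.

(* Upper bound: let the defect of a vertex set be the number of ordered pairs of
   vertices on opposite sides that are joined by no edge.  Start with a
   shortest cycle, which is induced, and grow a strong vertex set by shortest
   ears.  An ear with [r] new vertices creates at least [(k - 1) * r] missing
   pairs between the ear and the old set: inner vertices of the ear have no
   neighbour there, and the two ends miss about half of a shortest path that
   closes the ear into a cycle, whose length is at least [2k + 2].
   Lower bound: blow up two consecutive vertices of the directed cycle of length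
   [2k + 2] to independent sets. *)

(** * Shortest paths and sides along alternating paths *)

Lemma shortest_seq (T : finType) (P : pred (seq T)) (s : seq T) : P s ->
  exists2 s0, P s0 & forall s', P s' -> size s0 <= size s'.
Proof.
move=> Ps; pose Q n := [exists t : n.-tuple T, P t].
have QP s' : P s' -> Q (size s').
  by move=> Ps'; apply/existsP; exists (in_tuple s').
have exQ : exists n, Q n by exists (size s); apply: QP.
have [n /existsP[t Pt] min_n] := ex_minnP exQ.
by exists t => // s' /QP /min_n; rewrite size_tuple.
Qed.

(** Everything follows from minimal length: a repeated vertex, a later vertex in [B] or an earlier
    one in [A] would give a shorter walk from [B] to [A]. It serves twice, for the ear outside a
    strong set and for the return path inside it. *)
Lemma shortest_path (T : finType) (e : rel T) (A B : pred T) (b a : T) :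
  connect e b a -> B b -> A a ->
  exists x p, [/\ path e x p, B x, A (last x p), uniq (x :: p)
    & {in p, forall y, ~~ B y} /\ {in belast x p, forall y, ~~ A y}].
Proof.
move=> /connectP[p0 e_p0 ->] Bb Aa.
pose P s := if s is x :: p then [&& path e x p, B x & A (last x p)] else false.
have Pp0 : P (b :: p0) by rewrite /= e_p0 Bb Aa.
have [[|x p] //= /and3P[e_p Bx Ap] min_p] := shortest_seq Pp0.
exists x, p; split=> //; last split.
- case: (shortenP e_p) Ap => p' e_p' Up' sub_p' Ap'.
  have: size (x :: p) <= size (x :: p') by apply: min_p; rewrite /= e_p' Bx Ap'.
  move=> le_p; apply: leq_size_uniq Up' _ le_p => y; rewrite !inE => /orP[->//|/sub_p' ->].
  exact: orbT.
- move=> y p_y; apply/negP => By.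
  case/splitPr: p / p_y e_p Ap min_p => p1 p2.
  rewrite cat_path last_cat /= => /and3P[_ _ e_p2] Ap min_p.
  by have := min_p (y :: p2); rewrite /= e_p2 By Ap size_cat => /(_ isT) /=;
    rewrite ltnNge leq_addl.
- move=> y /(nthP x)[i]; rewrite size_belast => lt_i def_y; apply/negP => Ay.
  have := min_p (x :: take i p); rewrite /= take_path // Bx (last_nth x).
  have -> : nth x (x :: take i p) (size (take i p)) = y.
    rewrite size_take lt_i -[x :: _]/(take i.+1 (x :: p)) nth_take //.
    by rewrite lastI nth_rcons size_belast lt_i.
  by rewrite Ay size_take lt_i => /(_ isT); rewrite ltnS leqNgt lt_i.
Qed.

Lemma path_connect_last (T : finType) (e : rel T) (x v : T) (p : seq T) :
  path e x p -> v \in x :: p -> connect e v (last x p).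
Proof.
move=> e_p p_v; case/splitPl: p / p_v e_p => p1 p2 <-.
by rewrite cat_path last_cat => /andP[_ e_p2]; apply/connectP; exists p2.
Qed.

Lemma count_alternating (T : Type) (side : T -> bool) (x : T) (p : seq T) (b : bool) :
  path [rel u v | side u != side v] x p ->
  count (fun v => side v == b) p =
    if side x == b then (size p)./2 else uphalf (size p).
Proof.
elim: p x => [|y p IHp] x /=; first by case: ifP.
move=> /andP[xy /IHp ->]; rewrite uphalfE.
by move: xy; case: (side x); case: (side y); case: (b) => //= _; lia.
Qed.

Lemma last_alternating (T : Type) (side : T -> bool) (x : T) (p : seq T) :
  path [rel u v | side u != side v] x p ->
  side (last x p) = side x (+) odd (size p).
Proof.
elim: p x => [|y p IHp] x /=; first by rewrite addbF.
by move=> /andP[xy /IHp ->]; move: xy; case: (side x); case: (side y); case: (odd _).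
Qed.

Lemma count_belast_alternating (T : Type) (side : T -> bool) (x : T) (p : seq T) :
  path [rel u v | side u != side v] x p ->
  count (fun v => side v == side (last x p)) (belast x p) = (size p)./2.
Proof.
move=> alt_p.
have := count_alternating (side (last x p)) alt_p.
have : count (fun v => side v == side (last x p)) (x :: p) =
       count (fun v => side v == side (last x p)) (rcons (belast x p) (last x p)).
  by rewrite -lastI.
rewrite -cats1 count_cat /= eqxx (last_alternating alt_p).
by case: (side x); case: ifP; lia.
Qed.

Lemma sum_disjointU (T : finType) (A B : {set T}) (F : T -> nat) : [disjoint A & B] ->
  \sum_(v in A :|: B) F v = \sum_(v in A) F v + \sum_(v in B) F v.
Proof. by move=> dAB; rewrite -bigU //; apply: eq_bigl => v; rewrite !inE. Qed.

(** * Growth of strong vertex sets by ears *)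

Section UpperBound.

Variables (V : finType) (G : rel V) (side : V -> bool) (k : nat).
Hypothesis alternates : forall u v, G u v -> side u != side v.
Hypothesis long_closed_walks : forall x p,
  path G x p -> last x p = x -> p != [::] -> 2 * k < size p.

Definition nonadj (u v : V) := [&& side u != side v, ~~ G u v & ~~ G v u].
Definition nondeg (S : {set V}) (v : V) := \sum_(u in S) nonadj v u.
Definition defect (S : {set V}) := \sum_(v in S) nondeg S v.
Definition within (S : {set V}) := [rel u v | [&& u \in S, v \in S & G u v]].

Lemma nonadjC u v : nonadj u v = nonadj v u.
Proof. by rewrite /nonadj eq_sym [~~ G u v && _]andbC. Qed.

Lemma path_alternating x p : path G x p -> path [rel u v | side u != side v] x p.
Proof. by apply: sub_path => u v /alternates. Qed.

Lemma path_within S x p : path (within S) x p -> path G x p.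
Proof. by apply: sub_path => u v /and3P[]. Qed.

Lemma within_all (S : {set V}) x p : x \in S -> path (within S) x p -> {subset x :: p <= S}.
Proof.
elim: p x => [|y p IHp] x Sx /=; first by move=> _ z; rewrite inE => /eqP->.
case/andP=> /and3P[_ Sy _] /(IHp _ Sy) sub_p z.
by rewrite inE => /orP[/eqP->|/sub_p].
Qed.

Lemma connect_within (S S' : {set V}) : S \subset S' ->
  subrel (connect (within S)) (connect (within S')).
Proof.
move=> /subsetP sSS'; apply: connect_sub => u v /and3P[uS vS Guv].
by apply: connect1; rewrite /= !sSS'.
Qed.

Lemma uniq_nondeg (S : {set V}) v s :
  uniq s -> {in s, forall u, (u \in S) && nonadj v u} -> size s <= nondeg S v.
Proof.
move=> Us s_nonadj; rewrite /nondeg -big_mkcondr sum1_card -(card_uniqP Us).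
by apply/subset_leq_card/subsetP => u /s_nonadj.
Qed.

(** Pairs inside [P] are discarded; a pair between [H] and [P] counts in both orders because
    [nonadj] is symmetric. *)
Lemma defectU (H P : {set V}) : [disjoint H & P] ->
  defect H + 2 * \sum_(v in P) nondeg H v <= defect (H :|: P).
Proof.
move=> dHP.
have nondegU v : nondeg (H :|: P) v = nondeg H v + nondeg P v.
  by rewrite /nondeg sum_disjointU.
rewrite /defect sum_disjointU //= (eq_bigr _ (fun v _ => nondegU v)).
rewrite [X in _ <= _ + X](eq_bigr _ (fun v _ => nondegU v)) !big_split /=.
have -> : \sum_(v in H) nondeg P v = \sum_(v in P) nondeg H v.
  rewrite /nondeg exchange_big; apply: eq_bigr => u _.
  by apply: eq_bigr => v _; rewrite nonadjC.
lia.
Qed.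

(** The path is cut just before it first meets [H]. [entry_connect] is the mirror image: induction
    from the end cuts the path just after it last leaves [H]. *)
Lemma exit_connect (H : {set V}) u h : connect G u h -> u \notin H -> h \in H ->
  exists2 a, connect (within (~: H)) u a & [exists h' in H, G a h'].
Proof.
move=> /connectP[p]; elim: p u => [|y p IHp] u /=; first by move=> _ -> /negP.
case/andP=> Guy Gp eq_h uH hH; have [yH|yH] := boolP (y \in H).
  by exists u; rewrite ?connect0 //; apply/existsP; exists y; rewrite yH.
have [a ya Aa] := IHp y Gp eq_h yH hH; exists a => //.
by apply: connect_trans ya; apply: connect1; rewrite /= !inE uH yH.
Qed.

Lemma entry_connect (H : {set V}) h u : connect G h u -> h \in H -> u \notin H ->
  exists2 b, connect (within (~: H)) b u
    & (b \notin H) && [exists h' in H, G h' b].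
Proof.
move=> /connectP[p]; elim/last_ind: p u => [|p z IHp] u /=.
  by move=> _ -> ->.
rewrite rcons_path last_rcons => /andP[Gp Gz] -> hH zH.
have [lH|lH] := boolP (last h p \in H).
  by exists z; rewrite ?connect0 // zH; apply/existsP; exists (last h p); rewrite lH.
have [b bl Bb] := IHp _ Gp erefl hH lH; exists b => //.
by apply: connect_trans bl _; apply: connect1; rewrite /= !inE lH zH.
Qed.

(** The invariant of the growth. More than [k] vertices on each side guarantee that a vertex without
    neighbours in [H] misses at least [k + 1] vertices there. The last clause says that the defect
    is at least [2(k - 1)(#|H| - (k + 1))], written without truncated subtraction; the factor 2 is
    there because missing pairs are ordered. *)
Definition good (H : {set V}) :=
  [/\ {in H &, forall x y, connect (within H) x y},
      k < \sum_(v in H) side v, k < \sum_(v in H) ~~ side v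
    & 2 * (k - 1) * #|H| <= defect H + 2 * (k - 1) * (k + 1)].

Lemma good_opposite H v : good H -> k < \sum_(u in H) (side v != side u).
Proof.
case=> _ ltX ltY _; case: (side v); [apply: leq_trans ltY _ | apply: leq_trans ltX _];
  by rewrite eq_leq //; apply: eq_bigr => u _; case: (side u).
Qed.

(* The ear [x, p] and a shortest path of [H] from the out-neighbours of its end
   to the in-neighbours of its start form a closed walk.  The inner vertices of
   that path are not joined to the ends of the ear, and the inner vertices of
   the ear have no neighbour in [H] at all. *)
Lemma ear_nondeg (H : {set V}) x p : 0 < k -> good H ->
  path (within (~: H)) x p -> uniq (x :: p) -> x \notin H ->
  [exists h in H, G h x] -> [exists h in H, G (last x p) h] ->
  {in p, forall v, ~~ [exists h in H, G h v]} ->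
  {in belast x p, forall v, ~~ [exists h in H, G v h]} ->
  (k - 1) * size (x :: p) <= \sum_(v <- x :: p) nondeg H v.
Proof.
move=> k_gt0 goodH e_p Up xH /existsP[a /andP[aH Gax]] /existsP[b /andP[bH Gpb]] noB noA.
have [strongH _ _ _] := goodH.
have ba := strongH _ _ bH aH.
have [] := @shortest_path _ _ (fun h => (h \in H) && G h x)
  (fun h => (h \in H) && G (last x p) h) b a ba.
- by rewrite bH.
- by rewrite aH.
move=> q0 [q [e_q /andP[q0H Gpq0] /andP[qH Gqx] Uq [noB' noA']]].
have Gp := path_within e_p; have Gq := path_within e_q.
have subq := within_all q0H e_q.
have altp := path_alternating Gp; have altq := path_alternating Gq.
have long : 2 * k < (size p + size q).+2.
  have := @long_closed_walks x (p ++ q0 :: rcons q x).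
  rewrite cat_path last_cat /= last_rcons rcons_path Gp Gpq0 Gq Gqx.
  move=> /(_ isT erefl); rewrite size_cat /= size_rcons addnS addnS; apply.
  by case: (p).
(* The closed walk has length [size p + size q + 2], which is even by bipartiteness, so [long]
   improves to [2k <= size p + size q]. *)
have parity : odd (size p + size q) = false.
  have := last_alternating altp; have := last_alternating altq.
  have := alternates Gpq0; have := alternates Gqx; rewrite oddD.
  by case: (side x); case: (side q0); case: (side (last x p));
     case: (side (last q0 q)); case: (odd (size p)); case: (odd (size q)).
have cq0 := count_alternating (side q0) altq; rewrite eqxx in cq0.
have cq1 := count_belast_alternating altq.
case: (lastP p) => [|m z] in e_p Up Gpb noB noA noB' Gpq0 altp long parity Gp *.
  (* Ear with the single vertex [x]. An empty [q] would give a pair of opposite edges, against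
     [long]. Otherwise at least [k] vertices of [q] lie on the side of [q0]; the last one, [z], is
     an in-neighbour of [x], and the others, at least [k - 1], are missed by [x]. *)
  case: (lastP q) => [|q' z] in e_q Uq noA' noB' Gqx qH subq altq Gq long parity cq0 cq1 *.
    by clear -long k_gt0; move: long => /=; lia.
  rewrite big_seq1 /=.
  move: Uq; rewrite /= mem_rcons rcons_uniq => /and3P[_ _ Uq'].
  rewrite belast_rcons in noA'.
  have le_x : size [seq v <- q' | side v == side q0] <= nondeg H x.
    apply: uniq_nondeg; first exact: filter_uniq.
    move=> v; rewrite mem_filter => /andP[/eqP sv q'v].
    have qv : v \in rcons q' z by rewrite mem_rcons inE q'v orbT.
    have vH : v \in H by apply: subq; rewrite inE qv orbT.
    have := noB' _ qv; have := noA' v; rewrite inE q'v orbT => /(_ isT).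
    by rewrite vH /nonadj sv (alternates Gpq0) => -> ->.
  clear -k_gt0 cq0 le_x long parity; move: cq0 le_x long parity.
  rewrite size_filter -cats1 count_cat /= addn0 size_cat /=.
  by case: (_ == _); lia.
(* Longer ear, with [m] strictly between its ends [x] and [z]. Each end misses [(size q)./2]
   vertices. Every vertex of [m] shortens the guaranteed length of [q] by one, but misses [k + 1]
   vertices itself, two more than its share of [k - 1]. *)
rewrite belast_rcons in noA; rewrite last_rcons in Gpb Gpq0 noB'.
rewrite big_cons -cats1 big_cat big_seq1 /=.
have zp : z \in rcons m z by rewrite mem_rcons mem_head.
have le_x : (size q)./2 <= nondeg H x.
  rewrite -cq1 -size_filter; apply: uniq_nondeg.
    by apply: filter_uniq; move: Uq; rewrite lastI rcons_uniq => /andP[].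
  move=> v; rewrite mem_filter => /andP[/eqP sv qv].
  have vH : v \in H by apply: subq; rewrite lastI mem_rcons inE qv orbT.
  have := noA' _ qv; rewrite vH /= /nonadj => ->.
  rewrite sv eq_sym (alternates Gqx) andbT /=.
  apply: contra (noA x _); last by rewrite mem_head.
  by move=> Gxv; apply/existsP; exists v; rewrite vH.
have le_z : (size q)./2 <= nondeg H z.
  rewrite -cq0 -size_filter; apply: uniq_nondeg.
    by apply: filter_uniq; case/andP: Uq.
  move=> v; rewrite mem_filter => /andP[/eqP sv qv].
  have vH : v \in H by apply: subq; rewrite inE qv orbT.
  have := noB' _ qv; rewrite vH /= /nonadj => ->.
  rewrite sv (alternates Gpq0) /=.
  apply: contra (noB z zp).
  by move=> Gxv; apply/existsP; exists v; rewrite vH.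
have le_m : (k + 1) * size m <= \sum_(v <- m) nondeg H v.
  rewrite -sum1_size big_distrr big_seq [X in _ <= X]big_seq /=.
  apply: leq_sum => v mv; rewrite muln1; rewrite addn1; apply: leq_trans (good_opposite v goodH) _.
  apply: leq_sum => u uH; rewrite /nonadj.
  have nGuv : ~~ G u v.
    apply: contra (noB v _) => [Guv|]; last by rewrite mem_rcons inE mv orbT.
    by apply/existsP; exists u; rewrite uH.
  have nGvu : ~~ G v u.
    apply: contra (noA v _) => [Gvu|]; last by rewrite inE mv orbT.
    by apply/existsP; exists u; rewrite uH.
  by rewrite nGuv nGvu !andbT.
clear -k_gt0 le_x le_z le_m long parity; move: le_x le_z le_m long parity.
rewrite size_cat size_rcons /=; case: k k_gt0 => // k' _; rewrite subn1 /=.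
move: (nondeg H x) (nondeg H z) (\sum_(v <- m) _) (size q) (size m) => N N' M s j.
lia.
Qed.

(** Strongness leads from [H] to an outside vertex and back, so some walk avoiding [H] starts at an
    out-neighbour of [H] and ends at an in-neighbour. A shortest one is the ear, and [ear_nondeg]
    with [defectU] pays for its vertices. *)
Lemma good_ear (H : {set V}) : 0 < k -> (forall u v, connect G u v) -> good H ->
  H != setT -> exists2 H', good H' & #|H| < #|H'|.
Proof.
move=> k_gt0 strongG goodH; rewrite -subTset => /subsetPn[u _ uH].
have [strongH ltX ltY le_d] := goodH.
have [h hH] : exists h, h \in H.
  by apply/set0Pn; apply: contraTneq ltX => ->; rewrite big_set0.
have [a ua Aa] := exit_connect (strongG u h) uH hH.
have [b bu Bb] := entry_connect (strongG h u) hH uH.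
(* The clause [b \notin H] in [B] keeps [x] outside [H] even for an empty [p], where [within]
   imposes nothing. *)
have [x [p [e_p /andP[xH Bx] Ap Up [noB noA]]]] :=
  shortest_path (A := fun a => [exists h' in H, G a h'])
    (B := fun b => (b \notin H) && [exists h' in H, G h' b]) (connect_trans bu ua) Bb Aa.
have sub_p : {subset x :: p <= ~: H} by apply: within_all e_p; rewrite inE.
pose P := [set v in x :: p].
have dHP : [disjoint H & P].
  rewrite disjoint_sym; apply/pred0P => v /=; rewrite inE.
  by apply/negP => /andP[/sub_p]; rewrite inE => /negP.
have sHHP : H \subset H :|: P by apply: subsetUl.
exists (H :|: P); last first.
  rewrite cardsU (disjoint_setI0 dHP) cards0 subn0 -addn1 leq_add2l card_gt0.
  by apply/set0Pn; exists x; rewrite inE mem_head.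
have e_p' : path (within (H :|: P)) x p.
  have /allP : {subset x :: p <= H :|: P} by move=> v pv; rewrite in_setU in_set pv orbT.
  move=> allS; apply: (sub_in_path _ allS (path_within e_p)) => v w pv pw Gvw.
  exact/and3P.
have [h1 /andP[h1H Gh1]] := existsP Bx; have [h2 /andP[h2H Gh2]] := existsP Ap.
have from_h v : v \in P -> connect (within (H :|: P)) h1 v.
  rewrite inE => pv; apply: connect_trans (path_connect e_p' pv).
  have xP : x \in P by rewrite in_set mem_head.
  by apply: connect1; rewrite /= !in_setU h1H xP orbT.
have to_h v : v \in P -> connect (within (H :|: P)) v h2.
  rewrite inE => pv.
  have: connect (within (H :|: P)) (last x p) h2.
    have lP : last x p \in P by rewrite in_set mem_last.
    by apply: connect1; rewrite /= !in_setU h2H lP orbT.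
  exact/connect_trans/path_connect_last.
have inH := connect_within sHHP.
split.
- move=> v w; rewrite 2!in_setU => /orP[vH|vP] /orP[wH|wP].
  + exact/inH/strongH.
  + exact: connect_trans (inH _ _ (strongH _ _ vH h1H)) (from_h _ wP).
  + exact: connect_trans (to_h _ vP) (inH _ _ (strongH _ _ h2H wH)).
  + apply: connect_trans (to_h _ vP) (connect_trans _ (from_h _ wP)).
    exact: inH (strongH _ _ h2H h1H).
- by rewrite sum_disjointU //; apply: leq_trans ltX (leq_addr _ _).
- by rewrite sum_disjointU //; apply: leq_trans ltY (leq_addr _ _).
have noB' : {in p, forall v, ~~ [exists h in H, G h v]}.
  move=> v pv; have := noB v pv; rewrite negb_and negbK => /orP[vH|//].
  by have := sub_p v; rewrite inE pv orbT inE vH => /(_ isT).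
have := ear_nondeg k_gt0 goodH e_p Up xH Bx Ap noB' noA.
rewrite big_uniq //= -(eq_bigl _ _ (in_set (fun v => v \in x :: p))) -/P => le_ear.
apply: leq_trans (leq_add (defectU dHP) (leqnn _)).
rewrite cardsU (disjoint_setI0 dHP) cards0 subn0 mulnDr.
have -> : #|P| = size (x :: p) by rewrite cardsE; apply/card_uniqP.
clear -le_ear le_d; rewrite /=; move: le_ear; set N := (X in _ <= X); lia.
Qed.

Lemma good_shortest_cycle : 0 < k -> (exists2 c, cycle G c & c != [::]) ->
  exists H, good H.
Proof.
move=> k_gt0 [c0 Gc0 nc0].
have [c /andP[Gc nc] min_c] :=
  @shortest_seq _ [pred c | cycle G c && (c != [::])] c0 (introT andP (conj Gc0 nc0)).
pose S := [set v in c].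
(* Rotate the cycle to start at [u]. A chord at [u], in either direction, would close a shorter
   nonempty closed walk, so the successor and the predecessor are the only neighbours of [u] on the
   cycle. *)
have rotated u : u \in c -> exists c', [/\ path G u (rcons c' u),
    size c = (size c').+1, forall v, (v \in c) = (v \in u :: c') &
    {in c', forall v, (G u v -> v = head u c') /\ (G v u -> v = last u c')}].
  move=> cu; have [i c' def_c'] := rot_to cu.
  have Gc' : path G u (rcons c' u).
    by rewrite -[path _ _ _]/(cycle G (u :: c')) -def_c' rot_cycle.
  have szc : size c = (size c').+1 by rewrite -(size_rot i) def_c'.
  exists c'; split=> //; first by move=> v; rewrite -def_c' mem_rot.
  move=> v c'v; have [c1 [c2 eq_c']] : exists c1 c2, c' = c1 ++ v :: c2.
    by case/splitPr: c'v => c1 c2; exists c1, c2.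
  move: Gc' szc; rewrite {}eq_c' rcons_cat cat_path /= => /and3P[Gc1 Gc1v Gc2] szc; split=> Guv.
    have := min_c (u :: v :: c2); rewrite /= Guv Gc2 szc size_cat /= => /(_ isT).
    by case: c1 {Gc1 Gc1v szc} => //= *; lia.
  have := min_c (u :: rcons c1 v); rewrite /= !rcons_path Gc1 Gc1v last_rcons Guv.
  rewrite szc size_cat size_rcons /= last_cat /= => /(_ isT).
  by case: c2 {Gc2 szc} => //= *; lia.
have even_c : odd (size c) = false.
  case: c nc Gc {min_c S rotated} => // u c' _ /= Gc.
  have := last_alternating (path_alternating Gc).
  by rewrite last_rcons size_rcons /=; case: (side u); case: (odd _).
have half_c b : count (fun v => side v == b) c = (size c)./2.
  case: c nc Gc even_c {min_c S rotated} => // u c' _ /= Gc even_c.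
  have := count_alternating b (path_alternating Gc).
  rewrite -cats1 count_cat size_cat /= addn0 addn1 addnC => ->.
  by case: ifP => _; move: even_c => /=; clear; lia.
have sum_b b : \sum_(v <- c) (side v == b) = (size c)./2.
  by rewrite -(half_c b) -sum1_count [RHS]big_mkcond.
have Uc : uniq c.
  case: c nc Gc min_c {S rotated even_c half_c sum_b} => // x p _ /=.
  rewrite rcons_path => /andP[Gp Gx] min_c.
  case: (shortenP Gp) Gx => p' Gp' Up' sub_p' Gx.
  have le_p : size (x :: p) <= size (x :: p').
    by apply: min_c; rewrite /= rcons_path Gp' Gx.
  apply: leq_size_uniq Up' _ le_p => y; rewrite !inE => /orP[->//|/sub_p' ->].
  exact: orbT.
have long_c : 2 * k < size c.
  case: c nc Gc {min_c S rotated even_c half_c sum_b Uc} => // x p _ /= Gp.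
  by have := long_closed_walks Gp; rewrite last_rcons size_rcons; apply; case: (p).
have sumS F : \sum_(v in S) F v = \sum_(v <- c) F v :> nat.
  by rewrite [RHS]big_uniq //; apply: eq_bigl => v; rewrite inE.
have cardS : #|S| = size c by rewrite cardsE; apply/card_uniqP.
have nondegS u : u \in S -> (size c)./2 <= nondeg S u + 2.
  rewrite inE => /rotated[c' [Gc' szc memc extremal]].
  have Uuc' : uniq (u :: c').
    by apply: leq_size_uniq Uc _ _; rewrite /= ?szc // => v; rewrite memc.
  have [uc' Uc'] := andP Uuc'.
  have perm_c : perm_eq c (u :: c') by apply: uniq_perm.
  have := half_c (~~ side u); rewrite (permP perm_c) /=.
  have -> : (side u == ~~ side u) = false by case: (side u).
  rewrite add0n => <-.
  have le_nonadj : count (nonadj u) c' <= nondeg S u.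
    rewrite -size_filter; apply: uniq_nondeg; first exact: filter_uniq.
    by move=> v; rewrite mem_filter inE memc inE => /andP[-> ->]; rewrite orbT.
  have le_adj : count (fun v => G u v || G v u) c' <= 2.
    rewrite -size_filter (leq_trans (n := size [:: head u c'; last u c'])) //.
    apply: uniq_leq_size; first exact: filter_uniq.
    move=> v; rewrite mem_filter !inE => /andP[Guv /extremal[fw bw]].
    by case/orP: Guv => [/fw ->|/bw ->]; rewrite eqxx ?orbT.
  apply: leq_trans (leq_add le_nonadj le_adj).
  rewrite -count_predUI; apply: leq_trans (leq_addr _ _).
  apply: sub_count => v /= /eqP sv; rewrite /nonadj sv.
  by case: (side u); case: (G u v); case: (G v u).
exists S; split.
- move=> x y; rewrite !inE => cx cy; apply: connect_cycle cx cy.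
  have /allP : {subset c <= S} by move=> v; rewrite inE.
  move=> allS; apply: (sub_in_cycle _ allS Gc) => v w vS wS Gvw; exact/and3P.
- rewrite sumS (eq_bigr (fun v => side v == true : nat)) => [|v _]; last by case: (side v).
  by rewrite sum_b; clear -even_c long_c; lia.
- rewrite sumS (eq_bigr (fun v => side v == false : nat)) => [|v _]; last by case: (side v).
  by rewrite sum_b; clear -even_c long_c; lia.
have le_S : \sum_(u in S) (size c)./2 <= \sum_(u in S) (nondeg S u + 2) by apply: leq_sum.
rewrite big_split /= !sum_nat_const cardS -/(defect S) in le_S; rewrite cardS.
(* Let the length be [2L] with [L = k + 1 + l]. Each vertex misses at least [L - 2] of the [L]
   opposite ones, so the defect is at least [2L(L - 2)], which exceeds the bound in [good] by at
   least [2l(l + 2)]. *)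
have [l def_l] : exists l, size c = 2 * (k + 1 + l).
  by exists ((size c)./2 - (k + 1)); clear -even_c long_c; lia.
move: le_S; rewrite def_l mul2n doubleK; case: k k_gt0 => // k' _; rewrite subn1 /=.
clear; nia.
Qed.

(** The paths from [u] to [v] and back form a closed walk, nonempty since [u != v]. This yields a
    first good set, and ears then exhaust its complement. *)
Lemma good_setT : 0 < k -> (forall u v, connect G u v) -> (exists u v : V, u != v) ->
  good setT.
Proof.
move=> k_gt0 strongG [u [v uv]].
have [c0 Gc0 nc0] : exists2 c, cycle G c & c != [::].
  have [p Gp def_v] := connectP (strongG u v).
  have [q Gq def_u] := connectP (strongG v u).
  exists (p ++ q); last by case: p def_v {Gp} => //= /eqP; rewrite eq_sym (negbTE uv).
  rewrite (cycle_path u) last_cat -def_v -def_u cat_path Gp -def_v.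
  exact: Gq.
have [H] : exists H, good H by apply: good_shortest_cycle => //; exists c0.
have [n] := ubnP #|~: H|; elim: n H => // n IHn H leHn goodH.
have [<- //|nT] := eqVneq H setT.
have [H' goodH' ltHH'] := good_ear k_gt0 strongG goodH nT.
apply: IHn (goodH'); have := cardsC H; have := cardsC H'.
by move: ltHH' leHn; clear; lia.
Qed.

End UpperBound.

(** * From the defect of the whole vertex set to the number of edges *)

Lemma mfree_closed_walk (V : finType) (m : nat) (G : digraph V) (x : V) (p : seq V) :
  mfree m G -> path G x p -> last x p = x -> p != [::] -> m < size p.
Proof.
case: p => // y p freeG /= /andP[Gxy Gp] def_x _.
(* Making the walk after its first edge simple leaves a directed cycle that is no longer than the
   walk. *)
case: (shortenP Gp) def_x => p' Gp' Up' sub_p' def_x.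
apply: leq_trans (freeG (y :: p') _) _.
  by split=> //; rewrite /ucycle Up' andbT /= rcons_path Gp' def_x.
by rewrite ltnS uniq_leq_size //; case/andP: Up'.
Qed.

Lemma card_edges (V : finType) (G : digraph V) :
  #|edges G| = \sum_u \sum_v G u v.
Proof. by rewrite pair_bigA -sum1dep_card big_mkcond. Qed.

Lemma sum_opposite (V : finType) (X : {set V}) :
  \sum_u \sum_v ((u \in X) != (v \in X)) = 2 * (#|X| * #|~: X|).
Proof.
have sum_side (b : bool) : \sum_v (b != (v \in X)) = if b then #|~: X| else #|X|.
  case: b; rewrite -sum1_card [RHS]big_mkcond; apply: eq_bigr => v _;
  by rewrite ?inE; case: (v \in X).
rewrite (eq_bigr _ (fun u _ => sum_side _)) (bigID [in X]) /=.
rewrite (eq_bigr (fun _ => #|~: X|)) => [|u ->//].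
rewrite [X in _ + X](eq_bigr (fun _ => #|X|)) => [|u /negbTE->//].
rewrite !sum_nat_const mul2n -addnn [_ * #|X|]mulnC; congr (_ + _ * _).
by apply: eq_card => u; rewrite !inE.
Qed.

Lemma partite_setC (V : finType) (X Y : {set V}) :
  X :|: Y = [set: V] -> [disjoint X & Y] -> Y = ~: X.
Proof.
move=> cover disj; apply/setP => v; have := in_setT v; rewrite -cover !inE.
by have /pred0P/(_ v) /= := disj; case: (v \in X); case: (v \in Y).
Qed.

Lemma upper_bound (V : finType) (X Y : {set V}) (k : nat) (G : digraph V) :
  0 < k -> k < #|X| -> k < #|Y| ->
  bipartite X Y G -> mfree (2 * k) G -> strong G ->
  #|edges G| <= (#|X| - (k - 1)) * (#|Y| - (k - 1)) + 2 * k - 2.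
Proof.
move=> k_gt0 ltX ltY [cover disj bip] freeG strongG.
have def_Y := partite_setC cover disj.
have alt u v : G u v -> (u \in X) != (v \in X).
  by case/bip=> [[-> ]|[+ ->]]; rewrite def_Y inE => /negbTE->.
have long x p := @mfree_closed_walk V (2 * k) G x p freeG.
have [x xX] : exists x, x \in X by apply/card_gt0P/(leq_trans _ ltX).
have [y yY] : exists y, y \in Y by apply/card_gt0P/(leq_trans _ ltY).
have xy : x != y.
  by apply: contraTneq yY => <-; rewrite def_Y inE xX.
have [_ _ _] := good_setT alt long k_gt0 strongG (ex_intro _ x (ex_intro _ y xy)).
(* Of the [2 * (#|X| * #|Y|)] ordered opposite pairs, each edge takes up two, since opposite edges
   are excluded by [2k >= 2]; the defect counts the rest. *)
have two_edges : defect G [in X] setT + 2 * #|edges G| = 2 * (#|X| * #|Y|).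
  have -> : defect G [in X] setT = \sum_u \sum_v nonadj G [in X] u v.
    by apply: eq_big => [u|u _]; rewrite ?inE //; apply: eq_bigl => v; rewrite inE.
  rewrite def_Y -sum_opposite card_edges mul2n -addnn.
  rewrite [X in _ + (_ + X) = _]exchange_big -!big_split /=.
  apply: eq_bigr => u _; rewrite -!big_split; apply: eq_bigr => v _ /=.
  have no2 : ~~ (G u v && G v u).
    apply/negP => /andP[Guv Gvu]; have := long u [:: v; u].
    by rewrite /= Guv Gvu => /(_ isT erefl isT); clear -k_gt0; lia.
  move: no2 (introT implyP (alt u v)) (introT implyP (alt v u)); rewrite /nonadj.
  by case: (G u v); case: (G v u); case: (u \in X); case: (v \in X).
(* It remains that [|X||Y| - (k - 1)(|X| + |Y| - k - 1)] equals
   [(|X| - (k - 1))(|Y| - (k - 1)) + 2k - 2]. *)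
rewrite cardsT -(cardsC X) -def_Y.
have [n' def_n] : exists n', #|X| = n' + (k - 1) by exists (#|X| - (k - 1)); lia.
have [m' def_m] : exists m', #|Y| = m' + (k - 1) by exists (#|Y| - (k - 1)); lia.
move: two_edges; rewrite def_n def_m !addnK.
by move: (defect _ _ _) #|edges G|; clear -k_gt0; lia.
Qed.

(** * The blown-up directed cycle *)

Lemma leq_index_drop (T : eqType) (n : nat) (s : seq T) (v : T) :
  uniq s -> v \in drop n s -> n <= index v s.
Proof.
move=> Us dv; have lt_n : n < size s.
  by rewrite ltnNge; apply: contraTN dv => /drop_oversize ->.
move: Us; rewrite -{1}(cat_take_drop n s) cat_uniq => /and3P[_ /hasPn/(_ v dv) ntv _].
by rewrite -[s in index v s](cat_take_drop n) index_cat (negbTE ntv) size_takel ?leq_addr // ltnW.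
Qed.

Section Construction.

Variables (V : finType) (X Y : {set V}) (k : nat).
Hypotheses (k_gt0 : 0 < k) (def_Y : Y = ~: X) (ltX : k < #|X|) (ltY : k < #|Y|).

(* The surplus vertices of [X] and [Y] all land at levels [2k] and [2k + 1]. *)
Definition level (v : V) : nat :=
  if v \in X then 2 * minn (index v (enum X)) k
  else (2 * minn (index v (enum Y)) k).+1.

Definition level_edge : rel V :=
  [rel u v | level v == (level u).+1 %% (2 * k + 2)].

Lemma level_edgeE u v :
  level_edge u v = (level v == (level u).+1 %% (2 * k + 2)).
Proof. by []. Qed.

Lemma ltn_level v : level v < 2 * k + 2.
Proof.
rewrite /level; case: ifP => _; have := geq_minr (index v (enum X)) k;
have := geq_minr (index v (enum Y)) k; lia.
Qed.

Lemma odd_level v : odd (level v) = (v \notin X).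
Proof. by rewrite /level; case: (v \in X); rewrite /= mul2n odd_double. Qed.

Lemma level_path x p : path level_edge x p ->
  level (last x p) = (level x + size p) %% (2 * k + 2).
Proof.
elim: p x => [|y p IHp] x /=; first by rewrite addn0 modn_small // ltn_level.
by case/andP=> /eqP def_y /IHp ->; rewrite def_y modnDml addSnnS.
Qed.

Lemma level_edge_irr : irreflexive level_edge.
Proof.
move=> v; apply/negP => /eqP/(congr1 odd).
by rewrite odd_mod ?oddD ?mul2n ?odd_double //=; case: (odd _).
Qed.

Definition level_graph := Digraph level_edge_irr.

(** Since [l./2 <= k] and each part has more than [k] vertices, the part chosen by the parity of [l]
    has an entry at index [l./2], which the cap at [k] leaves unchanged. *)
Lemma level_onto l : l < 2 * k + 2 -> exists v, level v = l.
Proof.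
move=> lt_l; pose A := if odd l then Y else X.
have ltA : k < #|A| by rewrite /A; case: ifP.
have [x0 x0A] : exists x, x \in A by apply/card_gt0P/(leq_trans _ ltA).
have lt_i : l./2 < size (enum A) by rewrite -cardE; apply: leq_trans ltA; lia.
exists (nth x0 (enum A) l./2).
have := mem_nth x0 lt_i; rewrite mem_enum /level.
have : minn (index (nth x0 (enum A) l./2) (enum A)) k = l./2.
  by rewrite index_uniq ?enum_uniq //; lia.
move: {x0A} (nth _ _ _) => z; rewrite /A; case: ifP => odd_l def_i; last first.
  by move->; rewrite def_i; clear -odd_l; lia.
by rewrite {1}def_Y inE => /negbTE->; rewrite def_i; clear -odd_l; lia.
Qed.

Lemma card_drop_enum (A : {set V}) : #|[set v in drop k (enum A)]| = #|A| - k.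
Proof.
by rewrite cardsE (card_uniqP _) ?drop_uniq ?enum_uniq // size_drop -cardE.
Qed.

Lemma card_level_even : #|X| - k <= #|[set v | level v == 2 * k]|.
Proof.
rewrite -card_drop_enum; apply/subset_leq_card/subsetP => v; rewrite !inE => dv.
have := mem_drop dv; rewrite mem_enum /level => ->.
by rewrite (minn_idPr _) // leq_index_drop ?enum_uniq.
Qed.

Lemma card_level_odd : #|Y| - k <= #|[set v | level v == (2 * k).+1]|.
Proof.
rewrite -card_drop_enum; apply/subset_leq_card/subsetP => v; rewrite !inE => dv.
have := mem_drop dv; rewrite mem_enum def_Y inE /level => /negbTE->.
by rewrite (minn_idPr _) // leq_index_drop ?enum_uniq.
Qed.

Lemma level_connect u v : connect level_edge u v.
Proof.
have walk n w : level w = (level u + n.+1) %% (2 * k + 2) -> connect level_edge u w.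
  elim: n w => [|n IHn] w def_w; first by apply/connect1/eqP; rewrite def_w addn1.
  have [|z def_z] := @level_onto ((level u + n.+1) %% (2 * k + 2)).
    by rewrite ltn_pmod ?addn2.
  apply: connect_trans (IHn z def_z) _; apply/connect1/eqP.
  by rewrite def_w def_z -[(_ %% _).+1]addn1 modnDml addn1 -addnS.
(* [walk n] makes [n.+1] steps. A full extra turn, [2k + 2], keeps the number of steps positive when
   [level v] is at most [level u]. *)
apply: (walk (2 * k + 1 + level v - level u)).
have := ltn_level u; have := ltn_level v => ltv ltu.
have -> : level u + (2 * k + 1 + level v - level u).+1 = 2 * k + 2 + level v by lia.
by rewrite modnDl modn_small.
Qed.

(** A closed walk returns to its starting level, so its length is a multiple of [2k + 2]. *)
Lemma level_mfree : mfree (2 * k) level_graph.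
Proof.
move=> [|x p] [//= _ /andP[e_c _]].
have := level_path e_c; rewrite last_rcons size_rcons => def_x.
have : (2 * k + 2 %| (size p).+1).
  have := eqn_modDl (level x) (size p).+1 0 (2 * k + 2).
  by rewrite addn0 -def_x mod0n modn_small ?ltn_level // eqxx.
by move/dvdn_leq => /(_ isT) /=; lia.
Qed.

Lemma level_bipartite : bipartite X Y level_graph.
Proof.
split; first by rewrite def_Y setUCr.
  by rewrite def_Y disjoints_subset setCK.
move=> x y /eqP def_y.
have : odd (level y) = odd ((level x).+1 %% (2 * k + 2)) by rewrite -def_y.
rewrite odd_mod; last by rewrite oddD mul2n odd_double.
rewrite oddS !odd_level negbK def_Y !inE.
by case: (x \in X); case: (y \in X) => //= _; [left | right].
Qed.

Lemma level_card_edges :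
  (#|X| - (k - 1)) * (#|Y| - (k - 1)) + 2 * k - 2 <= #|edges level_graph|.
Proof.
pose a := #|X| - k; pose b := #|Y| - k.
pose A := [set v | level v == 2 * k]; pose B := [set v | level v == (2 * k).+1].
have [w def_w] : exists v, level v = (2 * k).-1 by apply: level_onto; lia.
(* Every vertex has an out-neighbour, those of [A] have at least [b], and [w], one level before [A],
   has at least [a]. Summing gives at least [|X| + |Y| + a(b - 1) + (a - 1)], that is
   [(a + 1)(b + 1) + 2k - 2]. *)
have outdeg u : 1 + (u \in A) * (b - 1) + (u == w) * (a - 1) <= \sum_v level_graph u v.
  have -> : \sum_v level_graph u v = #|[set v | level_edge u v]|.
    by rewrite -sum1_card [RHS]big_mkcond; apply: eq_bigr => z _; rewrite inE.
  have [v def_v] : exists v, level v = (level u).+1 %% (2 * k + 2).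
    by apply: level_onto; rewrite ltn_pmod; lia.
  have gt0 : 0 < #|[set v | level_edge u v]|.
    by apply/card_gt0P; exists v; rewrite inE; apply/eqP.
  rewrite inE; have [def_u|nA] := eqVneq (level u) (2 * k).
    have -> : (u == w) = false.
      by apply: contra_eqF def_u => /eqP ->; rewrite def_w; apply/eqP; clear -k_gt0; lia.
    have leB : b <= #|[set v | level_edge u v]|.
      apply: leq_trans card_level_odd _; rewrite eq_leq //; apply: eq_card => z.
      by rewrite !inE level_edgeE def_u modn_small //; clear; lia.
    by clear -gt0 leB; lia.
  have [def_u|_] := eqVneq u w; last by clear -gt0; lia.
  have leA : a <= #|[set v | level_edge u v]|.
    apply: leq_trans card_level_even _; rewrite eq_leq //; apply: eq_card => z.
    by rewrite !inE level_edgeE def_u def_w prednK ?modn_small //; clear -k_gt0; lia.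
  by clear -gt0 leA; lia.
rewrite card_edges.
apply: (@leq_trans (\sum_u (1 + (u \in A) * (b - 1) + (u == w) * (a - 1))));
  last by apply: leq_sum.
rewrite !big_split /= sum1_card -!big_distrl /=.
have -> : \sum_u (u == w) = 1 by rewrite -big_mkcond big_pred1_eq.
have -> : \sum_u (u \in A) = #|A| by rewrite -sum1_card [RHS]big_mkcond.
have -> : #|V| = #|X| + #|Y| by rewrite -(cardsC X) def_Y.
have [n' def_n] : exists n', #|X| = (n' + k).+1 by exists (#|X| - k.+1); lia.
have [m' def_m] : exists m', #|Y| = (m' + k).+1 by exists (#|Y| - k.+1); lia.
have := card_level_even; rewrite -/A /a /b def_n def_m -!addSn !addnK => leA.
have {leA} := leq_mul leA (leqnn m').
have -> : n'.+1 + k - (k - 1) = n' + 2 by clear -k_gt0; lia.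
have -> : m'.+1 + k - (k - 1) = m' + 2 by clear -k_gt0; lia.
by clear -k_gt0; lia.
Qed.

End Construction.

Theorem theorem1p5 (V : finType) (X Y : {set V}) (k : nat)
    (hk : 1 <= k) (hXY : [disjoint X & Y]) (hV : X :|: Y = [set: V])
    (hmin : k + 1 <= minn #|X| #|Y|) :
  turan_number
    (fun G : digraph V => [/\ bipartite X Y G, mfree (2 * k) G & strong G])
    ((#|X| - (k - 1)) * (#|Y| - (k - 1)) + 2 * k - 2).
Proof.
have /andP[ltX ltY] : (k < #|X|) && (k < #|Y|) by rewrite -leq_min -addn1.
have def_Y := partite_setC hV hXY.
split=> [G [bG fG sG]|]; first exact: upper_bound.
have bipG : bipartite X Y (level_graph X Y k) by apply: level_bipartite.
have freeG : mfree (2 * k) (level_graph X Y k) by apply: level_mfree.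
have strongG : strong (level_graph X Y k) by move=> u v; apply: level_connect.
exists (level_graph X Y k); split=> //.
(* The upper bound, applied to the construction itself, turns its lower estimate into an
   equality. *)
by apply/eqP; rewrite eqn_leq upper_bound //; apply: level_card_edges.
Qed.
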